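(* Let $\alpha>0$ with $\alpha\notin\{1,2,3,\dots\}$, let $n=[\alpha]+1$, let $m\in(0,1]$, let $q>1$ and $p=\frac{q}{q-1}$. Let $I\subset[0,\infty)$ be an interval, let $a,b\in I$ and let $x,y$ satisfy $a\le x<y\le b$; assume $z/m\in I$ for every $z\in[x,y]$. Let $f:I\to\mathbb{R}$ be $(n+1)$ times differentiable on $I$ with $f^{(n+1)}\in L[a,b]$. If $|f^{(n+1)}|^{q}$ is $m$-convex on $[x,y]$, then $$\left|\frac{1}{y-x}f^{(n)}(y)-\frac{(-1)^{n}\Gamma(n-\alpha+1)}{(y-x)^{n-\alpha+1}}({}^{C}D_{y^{-}}^{\alpha}f)(x)\right|$$ $$\le \left(\frac{1}{(n-\alpha+1)^{\frac1p}}\right)\left(\left|f^{(n+1)}(x)\right|^{q}\beta(2,n-\alpha+1)+m\left|f^{(n+1)}\left(\tfrac{y}{m}\right)\right|^{q}\frac{1}{2(n-\alpha)+1}\right)^{\frac1q}.$$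
   Context: $[\alpha]$ is the integer part of $\alpha$, $\Gamma$ is the Gamma function, $\beta(u,v)=\int_0^1 t^{u-1}(1-t)^{v-1}\,dt$ is the Beta function, and $L[a,b]$ is the space of Lebesgue integrable functions on $[a,b]$. At endpoints of $I$ belonging to $I$, derivatives are one-sided. Right-sided Caputo fractional derivative of order $\alpha$ (with $n=[\alpha]+1$): $$({}^{C}D_{y^{-}}^{\alpha}f)(x)=\frac{(-1)^n}{\Gamma(n-\alpha)}\int_x^y\frac{f^{(n)}(t)}{(t-x)^{\alpha-n+1}}\,dt\quad(x<y).$$ $m$-convexity: for $m\in(0,1]$, a function $g:I\to\mathbb{R}$ is called $m$-convex on $[c,d]\subset I$ (where $z/m\in I$ for all $z\in[c,d]$) if for all $u,v\in[c,d]$ and $t\in[0,1]$, $$g(tu+(1-t)v)=g\left(tu+m(1-t)\tfrac{v}{m}\right)\le t\,g(u)+m(1-t)\,g\left(\tfrac{v}{m}\right).$$ *)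

(* Defs.v *)
From HB Require Import structures.
From mathcomp Require Import all_boot all_order all_algebra.
From mathcomp Require Import all_classical all_reals all_analysis.

Set Implicit Arguments.
Unset Strict Implicit.
Unset Printing Implicit Defensive.

Import Order.TTheory GRing.Theory Num.Theory.
Import numFieldNormedType.Exports.

Local Open Scope classical_set_scope.
Local Open Scope ring_scope.

(* A function I -> R is represented by a total function R -> R. Derivatives
   are taken relative to I, so that at points of I they depend only on the
   values on I; at an endpoint of I belonging to I they are one-sided. *)
Definition diff_quotient_within {R : realType} (I : set R) (f : R -> R)
    (x : R) : set_system R :=
  (f z - f x) / (z - x) @[z --> within I x^'].

Definition derivable_within {R : realType} (I : set R) (f : R -> R) (x : R) :=
  cvg (diff_quotient_within I f x).

Definition derive_within {R : realType} (I : set R) (f : R -> R) (x : R) : R :=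
  lim (diff_quotient_within I f x).

Definition deriven_within {R : realType} (I : set R) (k : nat) (f : R -> R)
  : R -> R := iter k (derive_within I) f.

Definition derivable_n_within {R : realType} (I : set R) (k : nat)
    (f : R -> R) : Prop :=
  forall j, (j < k)%N ->
  forall x, I x -> derivable_within I (deriven_within I j f) x.

Definition Gamma_fun {R : realType} (z : R) : R :=
  \int[lebesgue_measure]_(t in `]0, +oo[) (t `^ (z - 1) * expR (- t)).

(* The library's beta_fun only takes natural-number arguments. *)
Definition Beta_fun {R : realType} (u v : R) : R :=
  \int[lebesgue_measure]_(t in `[0, 1]) (t `^ (u - 1) * (1 - t) `^ (v - 1)).

Definition caputo_right {R : realType} (I : set R) (alpha y : R) (f : R -> R)
    (x : R) : R :=
  let n := (Num.truncn alpha).+1 in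
  (- 1) ^+ n / Gamma_fun (n%:R - alpha) *
  \int[lebesgue_measure]_(t in `[x, y])
    (deriven_within I n f t / (t - x) `^ (alpha - n%:R + 1)).

(* To be used with 0 < m <= 1 and g defined on [c, d] and at all z / m for z
   in [c, d]. *)
Definition m_convex_on {R : realType} (m c d : R) (g : R -> R) : Prop :=
  forall u v t : R, c <= u <= d -> c <= v <= d -> 0 <= t <= 1 ->
  g (t * u + (1 - t) * v) <= t * g u + m * (1 - t) * g (v / m).

(* Main.v *)
(* Put s = n - alpha, so that 0 < s < 1, and F = f^(n), G = F' = f^(n+1). The
   quantity to be bounded is L(y) / (y - x)^(s+1), where
     L(t) = (t - x)^s F(t) - s \int_x^t (u - x)^(s-1) F(u) du
   vanishes at x and has derivative (t - x)^s G(t). By m-convexity |G|^q is at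
   most an affine function phi of t, and Young's inequality
     |G| <= (|G|^q / q + M / p) M^(-1/p)
   with a suitable constant M bounds |G| itself by an affine function. Comparing
   derivatives of L and of an explicit primitive then gives the bound on L(y);
   this is as sharp as Hoelder's inequality, but needs no integral of the
   possibly discontinuous G. The weight of |G(y/m)|^q that comes out is 1/(s+2), which is
   at most 1/(2s+1). *)

Require Import Defs.
From HB Require Import structures.
From mathcomp Require Import all_boot all_order all_algebra.
From mathcomp Require Import all_classical all_reals all_analysis.
From mathcomp Require Import unstable measurable_realfun ring lra.

Import Order.TTheory GRing.Theory Num.Theory.
Import numFieldNormedType.Exports.

Local Open Scope classical_set_scope.
Local Open Scope ring_scope.

(** * The fundamental theorem of calculus with a possible singularity at the left endpoint *)

(** Since [f] may blow up at [a], the classical theorem is applied on the intervals [[c n, b]],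
    which increase to []a, b]]. Nonnegativity allows monotone convergence, so integrability need not
    be known beforehand. *)
Lemma ge0_continuous_FTC2_oc (R : realType) (f F : R -> R) (a b : R) :
  a < b ->
  (forall x, a < x <= b -> 0 <= f x) ->
  (forall x, a < x <= b -> {for x, continuous f}) ->
  (forall x, a < x <= b -> is_derive x 1 F (f x)) ->
  F x @[x --> a^'+] --> F a ->
  (\int[lebesgue_measure]_(x in `]a, b]) (f x)%:E = (F b - F a)%:E)%E.
Proof.
move=> ab f0 cf dF Fa.
(* The denominator [n.+2] keeps [c n < b] strict already at [n = 0]. *)
pose c (n : nat) := a + (b - a) / n.+2%:R.
have ba0 : 0 < b - a by rewrite subr_gt0.
have ac n : a < c n by rewrite ltrDl divr_gt0.
have cb n : c n < b.
  by rewrite /c -ltrBrDl ltr_pdivrMr// ltr_pMr// ltr1n.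
have c_cvg : c n @[n --> \oo] --> a.
  rewrite -[X in _ --> X]addr0; apply: cvgD; first exact: cvg_cst.
  rewrite -(mulr0 (b - a)); apply: cvgM; first exact: cvg_cst.
  have := @cvg_harmonic R; rewrite -(cvg_shiftS (harmonic : nat -> R^o)); exact.
have cf_in n : {within `[c n, b], continuous f}.
  apply: continuous_in_subspaceT => x; rewrite inE/= in_itv/= => /andP[cx xb].
  by apply: cf; rewrite xb (lt_le_trans (ac n) cx).
have E n : (\int[lebesgue_measure]_(x in `[c n, b]) (f x)%:E = (F b - F (c n))%:E)%E.
  rewrite (@continuous_FTC2 _ f F)//.
  - have dFn x : c n <= x <= b -> is_derive x 1 F (f x).
      by move=> /andP[cx xb]; apply: dF; rewrite xb (lt_le_trans (ac n) cx).
    split.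
    + move=> x; rewrite in_itv/= => /andP[cx xb].
      by apply: ex_derive; apply: dFn; rewrite !ltW.
    + apply/cvg_at_right_filter/differentiable_continuous/derivable1_diffP.
      by apply: ex_derive; apply: dFn; rewrite lexx ltW.
    + apply/cvg_at_left_filter/differentiable_continuous/derivable1_diffP.
      by apply: ex_derive; apply: dFn; rewrite lexx ltW.
  - move=> x; rewrite in_itv/= => /andP[cx xb].
    rewrite derive1E; apply: derive_val; apply: dF.
    by rewrite (lt_trans (ac n) cx) ltW.
have U : `]a, b]%classic = \bigcup_n `[c n, b]%classic.
  apply/seteqP; split=> [x|x [n _]] /=; rewrite !in_itv/=.
    move=> /andP[ax xb].
    have /cvgrPdist_lt /(_ (x - a)) := c_cvg.
    rewrite subr_gt0 => /(_ ax)[n _ /(_ n)/=] /(_ (leqnn n)).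
    rewrite ltr0_norm ?subr_lt0// opprB ltrD2r => cx.
    by exists n => //=; rewrite in_itv/= xb ltW.
  by move=> /andP[cx ->]; rewrite (lt_le_trans (ac n) cx).
have I_cvg : (F b - F (c n))%:E @[n --> \oo] -->
    (\int[lebesgue_measure]_(x in `]a, b]) (f x)%:E)%E.
  under eq_fun do rewrite -E.
  rewrite U; apply: ge0_nondecreasing_set_cvg_integral => //.
  - move=> i j ij; apply/subsetPset/subset_itvr.
    by rewrite bnd_simp lerD2l ler_pM2l// lef_pV2 ?posrE// ler_nat.
  - move=> i; apply/measurable_EFinP.
    exact: subspace_continuous_measurable_fun.
  - move=> i x /=; rewrite in_itv/= => /andP[cx xb].
    by rewrite lee_fin f0// xb (lt_le_trans (ac i) cx).
apply: (cvg_unique _ I_cvg) => //.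
apply: cvg_EFin; first exact: nearW.
apply: cvgB; first exact: cvg_cst.
move/cvg_at_rightP : Fa; apply; split; [exact: ac|exact: c_cvg].
Qed.

(** * The recurrence of the Gamma function on []0, 1[] *)

Lemma continuous_powRl (R : realType) (r t : R) :
  0 < t -> {for t, continuous (@powR R ^~ r)}.
Proof.
move=> t0; apply/differentiable_continuous/derivable1_diffP.
by apply: derivable_powR; rewrite in_itv/= t0.
Qed.

(** For t >= 1, t^s <= t and e^t >= 1 + t^2/2, so the function is squeezed between 0 and 2/t. *)
Lemma powR_expRN_cvgy (R : realType) (s : R) : s <= 1 ->
  t `^ s * expR (- t) @[t --> +oo] --> (0 : R).
Proof.
move=> s1.
have lim0 : (t : R)^-1 *+ 2 @[t --> +oo] --> (0 : R).
  rewrite -(mul0rn _ 2).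
  apply: (@cvgMn _ _ _ _ _ (fun t : R => t^-1)).
  by apply/gtr0_cvgV0; [exact: nbhs_pinfty_gt|exact: cvg_id].
apply: (squeeze_cvgr _ (cvg_cst 0) lim0).
near=> t.
have t1 : 1 <= t by near: t; exact: nbhs_pinfty_ge.
have t0 : 0 < t by exact: lt_le_trans t1.
rewrite mulr_ge0 ?powR_ge0 ?expR_ge0//=.
have := @expR_ge1Dxn _ t 1 (ltW t0); rewrite factE /= => le_exp.
rewrite expRN ler_pdivrMr ?expR_gt0//.
have := ler_powR t1 s1; rewrite (powRr1 (ltW t0)) => /le_trans; apply.
rewrite -mulr_natr -mulrA ler_pdivlMl//; rewrite muln1 in le_exp; lra.
Unshelve. all: by end_near. Qed.

(* The difference s t^(s-1) e^-t - t^s e^-t is the derivative of t^s e^-t and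
   changes sign exactly at t = s: integrating separately over ]0, s] and
   [s, +oo[ involves only functions of constant sign. *)
Section Gamma.
Variables (R : realType) (s : R).
Hypotheses (s0 : 0 < s) (s1 : s < 1).
Let mu := @lebesgue_measure R.
Let w (r t : R) := t `^ r * expR (- t).

Let w_ge0 r t : 0 <= w r t.
Proof. by rewrite mulr_ge0 ?powR_ge0 ?expR_ge0. Qed.

Let w_measurable r A : measurable A -> measurable_fun A (w r).
Proof.
move=> mA; apply: measurable_funM.
  apply: measurable_funTS; exact: measurable_powR.
by apply: measurableT_comp => //; exact: measurableT_comp.
Qed.

Let w_continuous r t : 0 < t -> {for t, continuous (w r)}.
Proof.
move=> t0; apply: continuousM; first exact: continuous_powRl.
by apply: continuous_comp; [exact: continuousN|exact: continuous_expR].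
Qed.

Let w_derive (t : R) : 0 < t -> is_derive t 1 (w s) (s * w (s - 1) t - w s t).
Proof.
move=> t0; have ? := is_derive1_powR s t0.
apply: is_derive_eq; rewrite /w /GRing.scale/=.
by ring.
Qed.

Let w_powS t : 0 < t -> w s t = t * w (s - 1) t.
Proof. by move=> t0; rewrite /w mulrA mulr_powRB1// ltW. Qed.

Let V r := (\int[mu]_(t in `]0%R, s]) (w r t)%:E)%E.
Let U r := (\int[mu]_(t in `[s, +oo[) (w r t)%:E)%E.

(** The boundary term at 0 vanishes because s > 0. The identity is stated in the extended reals as a
    sum, which avoids subtracting integrals before their finiteness is known. *)
Let Vrec : (s%:E * V (s - 1) = V s + (w s s)%:E)%E.
Proof.
have <- : (\int[mu]_(t in `]0%R, s]) (s * w (s - 1) t - w s t)%:E = (w s s)%:E)%E.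
  transitivity (w s s - w s 0)%:E; last first.
    by rewrite [w s 0]/w powR0 ?gt_eqF// mul0r subr0.
  apply: ge0_continuous_FTC2_oc => //.
  - by move=> t /andP[t0 ts]; rewrite w_powS// -mulrBl mulr_ge0// subr_ge0.
  - move=> t /andP[t0 ts]; apply: continuousB; last exact: w_continuous.
    by apply: continuousM; [exact: cvg_cst|exact: w_continuous].
  - by move=> t /andP[t0 ts]; exact: w_derive.
  - have -> : w s 0 = 0 * expR (- 0) by rewrite /w powR0// gt_eqF.
    apply: cvgM; first exact: powR_cvg0.
    apply: cvg_at_right_filter.
    by apply: continuous_comp; [exact: continuousN|exact: continuous_expR].
rewrite -ge0_integralD//=; last 4 first.
- by move=> t _; rewrite lee_fin.
- by apply/measurable_EFinP; exact: w_measurable.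
- move=> t; rewrite in_itv/= => /andP[t0 ts].
  by rewrite lee_fin w_powS// -mulrBl mulr_ge0// subr_ge0.
- apply/measurable_EFinP; apply: measurable_funB; last exact: w_measurable.
  by apply: measurable_funM => //; exact: w_measurable.
rewrite -ge0_integralZl_EFin//=; last 3 first.
- by move=> t _; rewrite lee_fin.
- by apply/measurable_EFinP; exact: w_measurable.
- exact: ltW.
by apply: eq_integral => t _; rewrite -EFinD subrKC.
Qed.

Let Urec : (U s = s%:E * U (s - 1) + (w s s)%:E)%E.
Proof.
have <- : (\int[mu]_(t in `[s, +oo[) (w s t - s * w (s - 1) t)%:E = (w s s)%:E)%E.
  rewrite (@ge0_continuous_FTC2y _ _ (fun t => - w s t) _ 0)//.
  - by rewrite EFinN oppeK add0e.
  - move=> t st; rewrite w_powS ?(lt_le_trans s0)// -mulrBl.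
    by rewrite mulr_ge0// subr_ge0.
  - apply: continuous_in_subspaceT => t; rewrite inE/= in_itv/= andbT => st.
    have t0 := lt_le_trans s0 st.
    apply: continuousB; first exact: w_continuous.
    by apply: continuousM; [exact: cvg_cst|exact: w_continuous].
  - by rewrite -oppr0; apply: cvgN; apply: powR_expRN_cvgy; exact: ltW.
  - move=> t st; apply: derivableN.
    by apply: ex_derive; apply: w_derive; exact: lt_trans st.
  - by apply: cvgN; apply: cvg_at_right_filter; exact: w_continuous.
  - move=> t; rewrite in_itv/= andbT => st.
    have t0 := lt_trans s0 st.
    have ? := w_derive _ t0.
    by rewrite derive1E derive_val opprB.
rewrite -ge0_integralZl_EFin//=; last 3 first.
- by move=> t _; rewrite lee_fin.
- by apply/measurable_EFinP; exact: w_measurable.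
- exact: ltW.
rewrite -ge0_integralD//=; last 4 first.
- by move=> t _; rewrite lee_fin mulr_ge0// ltW.
- apply/measurable_EFinP.
  by apply: measurable_funM => //; exact: w_measurable.
- move=> t; rewrite in_itv/= andbT => st.
  by rewrite lee_fin w_powS ?(lt_le_trans s0)// -mulrBl mulr_ge0// subr_ge0.
- apply/measurable_EFinP; apply: measurable_funB; first exact: w_measurable.
  by apply: measurable_funM => //; exact: w_measurable.
by apply: eq_integral => t _; rewrite -EFinD addrC subrK.
Qed.

(** Only [V s] and [U (s - 1)] are estimated directly: t^s <= s^s on []0, s]], and t^(s-1) <=
    s^(s-1) on [[s, +oo[]. [Vrec] and [Urec] then give finite values for [V (s - 1)] and [U s]. *)
Let Vfin : V s \is a fin_num.
Proof.
rewrite ge0_fin_numE ?integral_ge0//; last by move=> t _; rewrite lee_fin.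
apply: (@le_lt_trans _ _ (\int[mu]_(t in `]0%R, s]) (s `^ s)%:E)%E).
  apply: ge0_le_integral => //=.
  - by move=> t _; rewrite lee_fin.
  - by apply/measurable_EFinP; exact: w_measurable.
  - move=> t; rewrite in_itv/= => /andP[t0 ts]; rewrite lee_fin.
    rewrite -[leRHS]mulr1 ler_pM ?powR_ge0 ?expR_ge0//.
      by apply: ge0_ler_powR => //; rewrite ?nnegrE ltW.
    by rewrite expR_le1 oppr_le0 ltW.
rewrite integral_cst//= lebesgue_measure_itv/= lte_fin s0.
by rewrite -EFinB -EFinM ltry.
Qed.

Let Ufin : U (s - 1) \is a fin_num.
Proof.
rewrite ge0_fin_numE ?integral_ge0//; last by move=> t _; rewrite lee_fin.
apply: (@le_lt_trans _ _
    (\int[mu]_(t in `[s, +oo[) ((s `^ (s - 1))%:E * (expR (- t))%:E))%E).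
  apply: ge0_le_integral => //=.
  - by move=> t _; rewrite lee_fin.
  - by apply/measurable_EFinP; exact: w_measurable.
  - apply/measurable_EFinP; apply: measurable_funM => //.
    by apply: measurableT_comp => //; exact: measurableT_comp.
  - move=> t; rewrite in_itv/= andbT => st; rewrite lee_fin.
    rewrite ler_pM ?powR_ge0 ?expR_ge0//.
    rewrite -opprB !powRN lef_pV2 ?posrE ?powR_gt0 ?(lt_le_trans s0 st)//.
    have := lt_le_trans s0 st => t0.
    by apply: ge0_ler_powR; rewrite ?nnegrE ?subr_ge0 // ltW.
have cexp (t : R) : {for t, continuous (fun t => expR (- t))}.
  by apply: continuous_comp; [exact: continuousN|exact: continuous_expR].
rewrite ge0_integralZl_EFin//=; last 2 first.
- apply/measurable_EFinP.
  by apply: measurableT_comp => //; exact: measurableT_comp.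
- exact: powR_ge0.
rewrite (@ge0_continuous_FTC2y _ _ (fun t => - expR (- t)) _ 0)//.
- by rewrite -EFinB -EFinM ltry.
- by apply: continuous_subspaceT => t; exact: cexp.
- by rewrite -oppr0; apply: cvgN; exact: cvgr_expR.
- by apply: cvgN; apply: cvg_at_right_filter; exact: cexp.
- by move=> t _; rewrite derive1E derive_val; ring.
Qed.

Let Gamma_split r : Gamma_fun (r + 1) = fine (V r + U r).
Proof.
rewrite /Gamma_fun /Rintegral; congr fine.
have -> : `]0%R, +oo[%classic = `]0%R, s] `|` `]s, +oo[%classic :> set R.
  by rewrite -itv_bndbnd_setU// bnd_simp ltW.
under eq_integral do rewrite addrK.
rewrite ge0_integral_setU//=.
- congr (_ + _)%E; apply: integral_itv_obnd_cbnd.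
  by apply/measurable_EFinP; exact: w_measurable.
- by apply/measurable_EFinP; apply: w_measurable; exact: measurableU.
- by move=> t _; rewrite lee_fin w_ge0.
- apply/disj_setPS => t [] /=; rewrite !in_itv/= andbT => /andP[_ ts].
  by rewrite ltNge ts.
Qed.

Lemma Gamma_fun_recurrence : Gamma_fun (s + 1) = s * Gamma_fun s /\ 0 < Gamma_fun s.
Proof.
rewrite -[in Gamma_fun s](subrK 1 s) !Gamma_split.
have ws0 : 0 < w s s by rewrite mulr_gt0 ?powR_gt0 ?expR_gt0.
have v0 : 0 <= fine (V s).
  by rewrite fine_ge0// integral_ge0// => t _; rewrite lee_fin.
have u0 : 0 <= fine (U (s - 1)).
  by rewrite fine_ge0// integral_ge0// => t _; rewrite lee_fin.
have -> : V (s - 1) = ((fine (V s) + w s s) / s)%:E.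
  have := Vrec; rewrite -[in V s](fineK Vfin) -EFinD => /(congr1 (mule (s^-1)%:E)).
  by rewrite muleA -EFinM mulVf ?gt_eqF// mul1e => ->; rewrite -EFinM mulrC.
rewrite Urec -[in U (s - 1)](fineK Ufin) -[in V s](fineK Vfin).
(* With v = V(s), u = U(s-1) and c = w(s,s) > 0, one has Gamma(s) = (v + c)/s + u and Gamma(s+1) = v
   + (s u + c). Positivity comes from c. *)
move: (fine (V s)) (fine (U (s - 1))) v0 u0 => v u v0 u0.
rewrite -!EFinM -!EFinD /=; split; first by field; rewrite gt_eqF.
by rewrite ltr_wpDr// divr_gt0// ltr_wpDl.
Qed.

End Gamma.

(** * Powers of t - x, their integrability, and the value of Beta(2, s+1) *)

Section power_shift.
Variables (R : realType) (x r : R).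

Lemma is_derive_powR_sub (t : R) : x < t ->
  is_derive t 1 (fun u => (u - x) `^ r) (r * (t - x) `^ (r - 1)).
Proof.
move=> xt.
have tx0 : 0 < t - x by rewrite subr_gt0.
have d1 : is_derive (t - x) 1 (@powR R ^~ r) (r * (t - x) `^ (r - 1)).
  exact: is_derive1_powR.
have d2 : is_derive t 1 (fun u => u - x) (1 : R).
  by apply: is_derive_eq; rewrite subr0.
have := @is_derive1_comp _ (@powR R ^~ r) (fun u => u - x) _ _ _ d1 d2.
by rewrite /GRing.scale/= mulr1; exact.
Qed.

Lemma powR_sub_cvg_right : 0 < r -> (t - x) `^ r @[t --> x^'+] --> 0.
Proof.
move=> r0.
apply: (@increasing_cvg_at_right_comp _ (fun t => t - x) (@powR R ^~ r) x +oo%O).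
- by [].
- by move=> u v _ _; rewrite ltrD2r.
- by apply: cvg_at_right_filter; apply: cvgB; [exact: cvg_id|exact: cvg_cst].
- by rewrite subrr; exact: powR_cvg0.
Qed.

Lemma powR_sub_within_continuous (y : R) : 0 < r -> x < y ->
  {within `[x, y], continuous (fun t => (t - x) `^ r)}.
Proof.
move=> r0 xy.
have cts t : x < t -> {for t, continuous (fun t => (t - x) `^ r)}.
  move=> xt; apply/differentiable_continuous/derivable1_diffP.
  by apply: ex_derive; exact: is_derive_powR_sub.
apply/(continuous_within_itvP _ xy); split.
- by move=> t; rewrite in_itv/= => /andP[xt _]; exact: cts.
- by rewrite subrr powR0 ?gt_eqF//; exact: powR_sub_cvg_right.
- by apply: cvg_at_left_filter; exact: cts.
Qed.

End power_shift.

(** For r < 1 the integrand is unbounded near x. Its integral over []x, y]] is obtained from the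
    primitive (t - x)^r, which is continuous at x since r > 0; the endpoint x is a null set. *)
Lemma integrable_powR_sub (R : realType) (x y r : R) : x < y -> 0 < r ->
  lebesgue_measure.-integrable `[x, y] (fun t => ((t - x) `^ (r - 1))%:E).
Proof.
move=> xy r0.
have mf A : measurable A ->
    measurable_fun A (fun t : measurableTypeR R => (t - x) `^ (r - 1)).
  move=> mA; apply: measurable_funTS.
  have mp : measurable_fun setT (fun u : measurableTypeR R => u `^ (r - 1)).
    exact: measurable_powR.
  by apply: (measurableT_comp mp); exact: measurable_funB.
have E : (\int[lebesgue_measure]_(t in `]x, y]) (r * (t - x) `^ (r - 1))%:E =
    ((y - x) `^ r - (x - x) `^ r)%:E)%E.
  apply: (@ge0_continuous_FTC2_oc _ _ (fun t => (t - x) `^ r)) => //.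
  - by move=> t _; rewrite mulr_ge0 ?powR_ge0 ?ltW.
  - move=> t /andP[xt _]; apply: continuousM; first exact: cvg_cst.
    apply/differentiable_continuous/derivable1_diffP.
    by apply: ex_derive; exact: is_derive_powR_sub.
  - by move=> t /andP[xt _]; exact: is_derive_powR_sub.
  - by rewrite subrr powR0 ?gt_eqF//; exact: powR_sub_cvg_right.
apply/integrableP; split; first by apply/measurable_EFinP; exact: mf.
under eq_integral do rewrite gee0_abs ?lee_fin ?powR_ge0//.
rewrite -integral_itv_obnd_cbnd; last by apply/measurable_EFinP; exact: mf.
have := E; under eq_integral do rewrite EFinM.
rewrite ge0_integralZl_EFin//=; last 3 first.
- by move=> t _; rewrite lee_fin powR_ge0.
- by apply/measurable_EFinP; exact: mf.
- exact: ltW.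
(* An infinite integral would stay infinite after multiplication by r > 0, contradicting the finite
   value in [E]. *)
case: (\int[_]_(_ in _) _)%E => [z| |] //; rewrite ?ltry//.
by rewrite gt0_muley ?lte_fin.
Qed.

(** The substitution t -> 1 - t turns the integrand into (1 - t) t^s, with primitive t^(s+1)/(s+1) -
    t^(s+2)/(s+2). The derivatives of these powers are used for t > 0 only, hence the half-open
    interval. *)
Lemma Beta_fun2 (R : realType) (s : R) : 0 < s ->
  Beta_fun 2 (s + 1) = 1 / ((s + 1) * (s + 2)).
Proof.
move=> s0; rewrite /Beta_fun.
have cG : {within `[0%R, 1%R], continuous
    (fun t : R => (1 - t) * t `^ s)}.
  have := @powR_sub_within_continuous R 0 s 1 s0 ltr01.
  under [X in {within _, continuous X}]eq_fun do rewrite subr0.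
  move=> /subspace_continuousP cp; apply/subspace_continuousP => t t01.
  apply: cvgM; last exact: cp.
  by apply: cvgB; [exact: cvg_cst|exact: cvg_within].
transitivity (\int[lebesgue_measure]_(t in `[0%R, 1%R]) ((1 - t) * t `^ s)).
  have r01 : 0 <= (1 : R) <= 1 by rewrite ler01 lexx.
  rewrite (Rintegration_by_substitution_onem r01 cG) onem1.
  apply: eq_Rintegral => t; rewrite inE/= in_itv/= => /andP[t0 t1].
  have -> : 2 - 1 = 1 :> R by ring.
  by rewrite /onem addrK subKr powRr1.
have icG : lebesgue_measure.-integrable `[0%R, 1%R]
    (EFin \o (fun t : R => (1 - t) * t `^ s)).
  by apply: continuous_compact_integrable => //; exact: segment_compact.
pose F (t : R) := t `^ (s + 1) / (s + 1) - t `^ (s + 2) / (s + 2).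
have s1 : 0 < s + 1 by lra.
have s2 : 0 < s + 2 by lra.
have F0 : F 0 = 0 by rewrite /F !powR0 ?gt_eqF// !mul0r subrr.
rewrite -Rintegral_itv_obnd_cbnd; last first.
  by apply: integrableS icG => //; exact: subset_itv_oc_cc.
transitivity (F 1 - F 0); last first.
  by rewrite F0 /F !powR1; field; rewrite !gt_eqF.
apply: (congr1 fine (y := (F 1 - F 0)%:E)).
apply: ge0_continuous_FTC2_oc => //.
- by move=> t /andP[t0 t1]; rewrite mulr_ge0 ?powR_ge0 ?subr_ge0.
- move=> t /andP[t0 t1]; apply: continuousM; last exact: continuous_powRl.
  by apply: continuousB; [exact: cvg_cst|exact: cvg_id].
- move=> t /andP[t0 t1].
  have d1 := @is_derive1_powR R (s + 1) t t0.
  have d2 := @is_derive1_powR R (s + 2) t t0.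
  apply: is_derive_eq.
  have -> : s + 2 - 1 = s + 1 by ring.
  rewrite addrK powRD ?(gt_eqF t0) ?implybT// powRr1 ?ltW//.
  rewrite /GRing.scale/=; field; by rewrite !gt_eqF.
- have -> : F 0 = 0 / (s + 1) - 0 / (s + 2) by rewrite F0 !mul0r subrr.
  by apply: cvgB; apply: cvgM; (try exact: cvg_cst); exact: powR_cvg0.
Qed.

(** * Derivatives relative to I, and a mean value inequality *)

Section within_derivative.
Variables (R : realType) (I : set R) (f : R -> R) (x : R).
Hypothesis df : derivable_within I f x.

(** Near x the quotient is bounded by |l| + 1, so |f z - f x| <= (|l| + 1) |z - x| along I. This
    covers endpoints of I, where the derivative is one-sided. *)
Lemma derivable_within_continuous_at : f z @[z --> within I (nbhs x)] --> f x.
Proof.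
move: df => /cvg_ex[/= l /cvgrPdist_lt fl].
have [d /= d0 dl] := fl 1 ltr01.
apply/cvgrPdist_lt => /= e e0.
have l1 : 0 < `|l| + 1 by rewrite ltr_wpDl.
exists (Num.min d (e / (`|l| + 1))) => /=.
  by rewrite lt_min d0 divr_gt0.
move=> z /=; rewrite lt_min => /andP[xzd xze] Iz.
have [->|zx] := eqVneq z x; first by rewrite subrr normr0.
have := dl z xzd zx Iz; rewrite distrC => lq.
have zx0 : z - x != 0 by rewrite subr_eq0.
rewrite distrC -(divfK zx0 (f z - f x)) normrM.
move: xze; rewrite ltr_pdivlMr// mulrC (distrC x) => /le_lt_trans; apply.
rewrite ler_wpM2r//.
rewrite -[X in `|X|](subrK l) (le_trans (ler_normD _ _))// addrC lerD2l.
exact: ltW.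
Qed.

(** At an interior point the restriction to I is void, so the quotient converges along the full
    punctured neighbourhood. Extended by its limit at x, it is the slope function of Caratheodory's
    criterion. *)
Lemma derivable_within_is_derive :
  nbhs x I -> is_derive x 1 f (derive_within I f x).
Proof.
move=> Ix.
have fl : (f z - f x) / (z - x) @[z --> x^'] --> derive_within I f x.
  apply: cvg_trans df => A /= IA.
  have Ix' : x^' I by apply: nbhs_dnbhs.
  by apply: filterS2 Ix' IA => z Iz /(_ Iz).
apply/is_derive1_caratheodory.
exists (fun z => if z == x then derive_within I f x
                 else (f z - f x) / (z - x)); split.
- move=> z; case: eqVneq => [->|zx]; first by rewrite !subrr mulr0.
  by rewrite divfK// subr_eq0.
- apply/continuous_withinNx; rewrite eqxx.
  apply: cvg_trans fl; apply: near_eq_cvg.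
  near=> z; rewrite ifF//; apply/negbTE; near: z.
  exact: nbhs_dnbhs_neq.
- by rewrite eqxx.
Unshelve. all: by end_near. Qed.

End within_derivative.

(** Both g - f and g + f have nonnegative derivative and are thus nondecreasing; no integrability of
    [df] enters. *)
Lemma norm_le_of_norm_derive_le (R : realType) (f g df dg : R -> R) (x y : R) :
  x <= y ->
  {within `[x, y], continuous f} -> {within `[x, y], continuous g} ->
  (forall t, x < t < y -> is_derive t 1 f (df t)) ->
  (forall t, x < t < y -> is_derive t 1 g (dg t)) ->
  (forall t, x < t < y -> `|df t| <= dg t) ->
  `|f y - f x| <= g y - g x.
Proof.
move=> xy cf cg Df Dg dfg.
have key (h dh : R -> R) : {within `[x, y], continuous h} ->
    (forall t, x < t < y -> is_derive t 1 h (dh t)) ->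
    (forall t, x < t < y -> 0 <= dh t) -> h x <= h y.
  move=> ch Dh dh0.
  apply: (@ger0_derive1_le_cc _ h x y) => //; rewrite ?in_itv/= ?lexx ?andbT//.
  - by move=> t; rewrite in_itv/= => /Dh d; exact: ex_derive.
  - move=> t; rewrite in_itv/= => xty; have d := Dh _ xty.
    by rewrite derive1E derive_val dh0.
have p1 : g x - f x <= g y - f y.
  apply: (key (g - f) (dg - df)) => [|t xty|t xty].
  - move/subspace_continuousP: cg => cg; move/subspace_continuousP: cf => cf.
    by apply/subspace_continuousP => t txy; apply: cvgB; [exact: cg|exact: cf].
  - by have d1 := Df _ xty; have d2 := Dg _ xty; exact: is_deriveB.
  - by rewrite subr_ge0 (le_trans (ler_norm _))// dfg.
have p2 : g x + f x <= g y + f y.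
  apply: (key (g + f) (dg + df)) => [|t xty|t xty].
  - move/subspace_continuousP: cg => cg; move/subspace_continuousP: cf => cf.
    by apply/subspace_continuousP => t txy; apply: cvgD; [exact: cg|exact: cf].
  - by have d1 := Df _ xty; have d2 := Dg _ xty; exact: is_deriveD.
  - rewrite -[leRHS]/(dg t + df t) -lerBlDr sub0r.
    by rewrite (le_trans _ (dfg _ xty))// -normrN ler_norm.
by rewrite ler_norml; lra.
Qed.

(** * The weighted comparison of derivatives *)

Lemma weighted_derivative_bound (R : realType) (F G : R -> R)
    (x y s c0 c1 : R) : 0 < s -> x < y ->
  {within `[x, y], continuous F} ->
  (forall t, x < t < y -> is_derive t 1 F (G t)) ->
  (forall t, x < t < y -> `|G t| <= c0 + c1 * (t - x)) ->
  `|(y - x) `^ s * F y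
    - s * \int[lebesgue_measure]_(t in `[x, y]) (F t / (t - x) `^ (1 - s))|
  <= c0 / (s + 1) * (y - x) `^ (s + 1) + c1 / (s + 2) * (y - x) `^ (s + 2).
Proof.
move=> s0 xy cF dF Gle.
have s1 : 0 < s + 1 by lra.
have s2 : 0 < s + 2 by lra.
pose k (t : R) := F t / (t - x) `^ (1 - s).
have kE t : k t = F t * (t - x) `^ (s - 1) by rewrite /k -powRN opprB.
have cpt : compact (`[x, y]%classic : set R) by exact: segment_compact.
(* F is continuous, hence bounded, on the compact [[x, y]], and the possibly singular factor (t -
   x)^(s-1) is integrable. *)
have ik : lebesgue_measure.-integrable `[x, y] (EFin \o k).
  rewrite (_ : _ \o k = (EFin \o F) \* (fun t => ((t - x) `^ (s - 1))%:E))%E.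
    apply: integrableMr => //.
    - exact: subspace_continuous_measurable_fun.
    - have /compact_bounded[M [_ mrt]] := continuous_compact cF cpt.
      by exists M; split; rewrite ?num_real // => ? ? ? ?; exact: mrt.
    - exact: integrable_powR_sub.
  by apply/funext => t /=; rewrite kE EFinM.
pose P (t : R) := \int[lebesgue_measure]_(u in `[x, t]) k u.
(* The kernel may be singular at x, so [P] is differentiated only inside the interval. Its
   continuity up to the endpoints follows from integrability and suffices for the comparison. *)
have dP t : x < t < y -> is_derive t 1 P (k t).
  move=> /andP[xt ty].
  have ck : {for t, continuous k}.
    have -> : k = (fun u => F u * (u - x) `^ (s - 1)) by apply/funext => u; exact: kE.
    apply: continuousM; apply/differentiable_continuous/derivable1_diffP.
      by have := dF t; rewrite xt ty => /(_ isT) d; exact: ex_derive.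
    by apply: ex_derive; exact: is_derive_powR_sub.
  have [d1 d2] := continuous_FTC1_closed ty ik xt ck.
  by rewrite -d2 derive1E; apply: derivableP.
have cP : {within `[x, y], continuous P}.
  by apply: (parameterized_integral_continuous (ltW xy)).
(* In L' the term s (t - x)^(s-1) F from the product rule cancels against s P'. [K] is the primitive
   of (t - x)^s (c0 + c1 (t - x)) vanishing at x. *)
pose L (t : R) := (t - x) `^ s * F t - s * P t.
pose K (t : R) := c0 / (s + 1) * (t - x) `^ (s + 1)
                  + c1 / (s + 2) * (t - x) `^ (s + 2).
have Lx : L x = 0.
  rewrite /L subrr powR0 ?gt_eqF// mul0r /P set_itv1 Rintegral_set1.
  by rewrite mulr0 subrr.
have Kx : K x = 0 by rewrite /K subrr !powR0 ?gt_eqF// !mulr0 addr0.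
have : `|L y - L x| <= K y - K x.
  apply: (@norm_le_of_norm_derive_le _ _ _
    (fun t => (t - x) `^ s * G t) (fun t => (t - x) `^ s * (c0 + c1 * (t - x)))).
  - exact: ltW.
  - move/subspace_continuousP : cF => cF; move/subspace_continuousP : cP => cP.
    have /subspace_continuousP cp := powR_sub_within_continuous _ _ _ _ s0 xy.
    apply/subspace_continuousP => t txy; apply: cvgB.
      by apply: cvgM; [exact: cp|exact: cF].
    by apply: cvgM; [exact: cvg_cst|exact: cP].
  - have /subspace_continuousP cp1 := powR_sub_within_continuous _ _ _ _ s1 xy.
    have /subspace_continuousP cp2 := powR_sub_within_continuous _ _ _ _ s2 xy.
    apply/subspace_continuousP => t txy; apply: cvgD.
      by apply: cvgM; [exact: cvg_cst|exact: cp1].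
    by apply: cvgM; [exact: cvg_cst|exact: cp2].
  - move=> t xty; have [xt _] := andP xty.
    have d1 := dF _ xty; have d2 := dP _ xty.
    have d3 := is_derive_powR_sub _ x s t xt.
    apply: is_derive_eq.
    by rewrite kE /GRing.scale/=; ring.
  - move=> t xty; have [xt _] := andP xty.
    have d1 := is_derive_powR_sub _ x (s + 1) t xt.
    have d2 := is_derive_powR_sub _ x (s + 2) t xt.
    have tx0 : 0 < t - x by rewrite subr_gt0.
    apply: is_derive_eq.
    have -> : s + 2 - 1 = s + 1 by ring.
    rewrite addrK powRD ?(gt_eqF tx0) ?implybT// powRr1 ?(ltW tx0)//.
    by rewrite /GRing.scale/=; field; rewrite !gt_eqF.
  - move=> t xty; rewrite normrM ger0_norm ?powR_ge0// ler_wpM2l ?powR_ge0//.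
    exact: Gle.
by rewrite Lx Kx !subr0.
Qed.

(** * From an affine bound on the q-th power to an affine bound on the function *)

(** The right-hand side is the tangent at M to the concave function w^(1/q), taken at w = u^q. The
    inequality is Young's for u and M^(1/p), divided by M^(1/p). *)
Lemma powR_tangent (R : realType) (p q u M : R) :
  0 < p -> 0 < q -> p^-1 + q^-1 = 1 -> 0 <= u -> 0 < M ->
  u <= (u `^ q / q + M / p) * M `^ (- p^-1).
Proof.
move=> p0 q0 pq u0 M0.
rewrite powRN ler_pdivlMr ?powR_gt0//.
apply: le_trans (conjugate_powR u0 (powR_ge0 M p^-1) q0 p0 _) _.
  by rewrite addrC.
by rewrite -powRrM mulVf ?gt_eqF// (powRr1 (ltW M0)).
Qed.

(** Inserting the affine bound of h^q into a tangent of w^(1/q) keeps it affine. The left side of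
    the last inequality is the integral over [0, 1] of r^s (c0 + c1 (y - x) r). *)
Lemma affine_majorant (R : realType) (p q s A B x y : R) (h : R -> R) :
  1 < q -> p = q / (q - 1) -> 0 < s < 1 -> 0 <= A -> 0 <= B -> x < y ->
  (forall t, x < t < y -> 0 <= h t) ->
  (forall t, x < t < y ->
     h t `^ q <= A + (B - A) * ((t - x) / (y - x))) ->
  exists c0 c1,
    (forall t, x < t < y -> h t <= c0 + c1 * (t - x)) /\
    c0 / (s + 1) + c1 * (y - x) / (s + 2) <=
      1 / (s + 1) `^ (1 / p) *
      (A * (1 / ((s + 1) * (s + 2))) + B * (1 / (2 * s + 1))) `^ (1 / q).
Proof.
move=> q1 pE /andP[s0 s1] A0 B0 xy h0 hq.
have q0 : 0 < q by lra.
have p0 : 0 < p by rewrite pE divr_gt0// subr_gt0.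
have pq : p^-1 + q^-1 = 1.
  by rewrite pE; field; rewrite subr_eq0 !gt_eqF.
have D0 : 0 < y - x by rewrite subr_gt0.
have sp1 : 0 < s + 1 by lra.
have sp2 : 0 < s + 2 by lra.
have s21 : 0 < 2 * s + 1 by lra.
set J := A * _ + B * _.
(* If J = 0 there is no positive tangency point; but then A = B = 0, which forces h = 0 on the open
   interval. *)
have [J0|J0] := eqVneq J 0.
  have := J0 => /eqP; rewrite paddr_eq0; last 2 first.
  - by rewrite mulr_ge0// divr_ge0// mulr_ge0// ltW.
  - by rewrite mulr_ge0// divr_ge0// ltW.
  rewrite !mulf_eq0 !invr_eq0 mulf_eq0 oner_eq0 /=
    (gt_eqF sp1) (gt_eqF sp2) (gt_eqF s21) ?orbF.
  move=> /andP[/eqP A_0 /eqP B_0].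
  exists 0, 0; split=> [t xty|]; last first.
    by rewrite !mul0r addr0 mulr_ge0 ?powR_ge0// divr_ge0 ?powR_ge0.
  have := hq t xty; rewrite A_0 B_0 subrr mul0r addr0 => hle.
  have /powR_eq0_eq0 -> : h t `^ q = 0.
    by apply/eqP; rewrite eq_le hle powR_ge0.
  by rewrite mul0r addr0.
have Jgt0 : 0 < J.
  rewrite lt_neqAle eq_sym J0/=.
  by rewrite addr_ge0// mulr_ge0// divr_ge0// ?mulr_ge0// ltW.
(* The mean of the affine majorant for the weight t^s, up to the loss
   1 / (s + 2) <= 1 / (2 s + 1). *)
pose M := (s + 1) * J.
have M0 : 0 < M by rewrite mulr_gt0.
pose N := M `^ (- p^-1).
have N0 : 0 < N by rewrite powR_gt0.
exists ((A / q + M / p) * N), ((B - A) / (q * (y - x)) * N); split.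
  move=> t xty.
  apply: le_trans (powR_tangent _ _ _ _ _ p0 q0 pq (h0 t xty) M0) _.
  rewrite -/N.
  have -> : (A / q + M / p) * N + (B - A) / (q * (y - x)) * N * (t - x) =
      ((A + (B - A) * ((t - x) / (y - x))) / q + M / p) * N.
    by field; rewrite !gt_eqF.
  by rewrite ler_pM2r// lerD2r ler_pM2r ?invr_gt0// hq.
(* This is where the choice of M pays off: M^(-1/p) J = (s+1)^(-1/p) J^(1 - 1/p), and 1 - 1/p =
   1/q. *)
have -> : 1 / (s + 1) `^ (1 / p) * J `^ (1 / q) = N * J.
  rewrite !div1r -powRN /N /M powRM ?ltW// -mulrA; congr (_ * _).
  have -> : q^-1 = - p^-1 + 1 by lra.
  by rewrite powRD ?(gt_eqF Jgt0) ?implybT// powRr1 ?ltW.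
have -> : (A / q + M / p) * N / (s + 1) +
    (B - A) / (q * (y - x)) * N * (y - x) / (s + 2) =
    N * ((A * (1 / ((s + 1) * (s + 2))) + B * (1 / (s + 2))) * q^-1 + J * p^-1).
  by rewrite /M; field; rewrite !gt_eqF.
rewrite ler_pM2l//.
(* After J is split by 1/q + 1/p = 1, only the coefficients of B differ: 1/(s+2) <= 1/(2s+1), which
   holds because s < 1. *)
have {2}-> : J = J * q^-1 + J * p^-1 by rewrite -mulrDr addrC pq mulr1.
rewrite lerD2r ler_pM2r ?invr_gt0// lerD2l ler_wpM2l// !div1r.
by rewrite lef_pV2 ?posrE//; lra.
Qed.

(** * Assembly of the inequality for the Caputo derivative *)

Theorem theorem6 (R : realType) (alpha : R) (n : nat) (m q p : R)
    (I : set R) (a b x y : R) (f : R -> R)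
    (alpha_gt0 : 0 < alpha)
    (alpha_nnat : forall k : nat, (0 < k)%N -> alpha <> k%:R)
    (n_def : n = (Num.truncn alpha).+1)
    (m_gt0 : 0 < m) (m_le1 : m <= 1)
    (q_gt1 : 1 < q) (p_def : p = q / (q - 1))
    (I_itv : is_interval I) (I_ge0 : I `<=` `[0, +oo[)
    (Ia : I a) (Ib : I b)
    (le_ax : a <= x) (lt_xy : x < y) (le_yb : y <= b)
    (I_divm : forall z, x <= z <= y -> I (z / m))
    (f_diff : derivable_n_within I n.+1 f)
    (f_int : lebesgue_measure.-integrable `[a, b]
               (fun t => (deriven_within I n.+1 f t)%:E))
    (f_mconvex : m_convex_on m x y
                   (fun t => `|deriven_within I n.+1 f t| `^ q)) :
  `| 1 / (y - x) * deriven_within I n f y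
     - (- 1) ^+ n * Gamma_fun (n%:R - alpha + 1)
       / (y - x) `^ (n%:R - alpha + 1) * caputo_right I alpha y f x |
  <= 1 / (n%:R - alpha + 1) `^ (1 / p)
     * (`|deriven_within I n.+1 f x| `^ q * Beta_fun 2 (n%:R - alpha + 1)
        + m * `|deriven_within I n.+1 f (y / m)| `^ q
          * (1 / (2 * (n%:R - alpha) + 1))) `^ (1 / q).
Proof.
have [s0 s1] : 0 < n%:R - alpha /\ n%:R - alpha < 1.
  have /andP[lo hi] := truncn_itv (ltW alpha_gt0).
  rewrite -n_def in hi.
  (* Strictness gives s < 1. Equality would make alpha a positive integer, or zero when its integer
     part is 0. *)
  have : (Num.truncn alpha)%:R < alpha.
    rewrite lt_neqAle lo andbT; apply/eqP => E.
    have [t0|/alpha_nnat] := posnP (Num.truncn alpha); last by rewrite E.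
    by move: alpha_gt0; rewrite -E t0 ltxx.
  rewrite subr_gt0 hi ltrBlDr n_def -natr1 addrC ltrD2l; by split.
set s := n%:R - alpha in s0 s1 *.
have s01 : 0 < s < 1 by rewrite s0.
pose F := deriven_within I n f.
pose G := deriven_within I n.+1 f.
have D0 : 0 < y - x by rewrite subr_gt0.
have Itv t : x <= t <= y -> I t.
  move=> /andP[xt ty]; apply: (I_itv _ _ Ia Ib).
  by rewrite (le_trans le_ax xt) (le_trans ty le_yb).
have cF : {within `[x, y], continuous F}.
  apply/subspace_continuousP => t xty.
  have It : I t by apply: Itv; move: xty; rewrite /= in_itv.
  apply: cvg_trans (derivable_within_continuous_at _ _ _ _ (f_diff n (ltnSn n) t It)).
  apply: cvg_app; apply: within_subset => z /=; rewrite in_itv/=; exact: Itv.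
have dF t : x < t < y -> is_derive t 1 F (G t).
  move=> xty; apply: derivable_within_is_derive.
    apply: (f_diff n (ltnSn n) t); apply: Itv.
    by have /andP[/ltW-> /ltW->] := xty.
  have : \forall z \near t, z \in `]x, y[ by apply: near_in_itvoo; rewrite in_itv.
  apply: filterS => z; rewrite in_itv/= => /andP[/ltW xz /ltW zy].
  by apply: Itv; rewrite xz zy.
pose A := `|G x| `^ q; pose B := m * `|G (y / m)| `^ q.
(* This is m-convexity at u = x, v = y with weight l = (y - t)/(y - x). The factor m and the point
   y/m are both absorbed into [B]. *)
have hG t : x < t < y -> `|G t| `^ q <= A + (B - A) * ((t - x) / (y - x)).
  move=> /andP[xt ty].
  have xx : x <= x <= y by rewrite lexx ltW.
  have yy : x <= y <= y by rewrite lexx ltW.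
  pose l := (y - t) / (y - x).
  have l01 : 0 <= l <= 1.
    apply/andP; split; first by rewrite divr_ge0 ?subr_ge0 ?ltW.
    by rewrite ler_pdivrMr// mul1r lerD2l lerN2 ltW.
  have := f_mconvex x y l xx yy l01.
  have -> : l * x + (1 - l) * y = t by rewrite /l; field; rewrite gt_eqF.
  rewrite -/(G t) -/(G x) -/(G _) => /le_trans; apply.
  rewrite le_eqVlt; apply/orP; left; apply/eqP.
  by rewrite -/A /B /l; field; rewrite gt_eqF.
have A0 : 0 <= A by exact: powR_ge0.
have B0 : 0 <= B by rewrite mulr_ge0 ?powR_ge0// ltW.
have [c0 [c1 [Gle cle]]] := affine_majorant _ _ _ _ _ _ _ _ (fun t => `|G t|)
  q_gt1 p_def s01 A0 B0 lt_xy (fun t _ => normr_ge0 _) hG.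
have W := weighted_derivative_bound _ _ _ _ _ _ _ _ s0 lt_xy cF dF Gle.
have [GE G0] := Gamma_fun_recurrence _ _ s0 s1.
rewrite GE Beta_fun2// -/F -/(G x) -/(G _) -/A -/B.
rewrite /caputo_right -n_def -/F -/s.
have -> : alpha - n%:R + 1 = 1 - s by rewrite /s; ring.
set w := \int[_]_(_ in _) _ in W *.
have Ds0 : 0 < (y - x) `^ s by rewrite powR_gt0.
have DE1 : (y - x) `^ (s + 1) = (y - x) `^ s * (y - x).
  by rewrite powRD ?(gt_eqF D0) ?implybT// powRr1 ?ltW.
have DE2 : (y - x) `^ (s + 2) = (y - x) `^ s * (y - x) ^+ 2.
  by rewrite powRD ?(gt_eqF D0) ?implybT// powR_mulrn ?ltW.
rewrite DE1 DE2 in W *.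
have ee : (-1) ^+ n * (-1) ^+ n = 1 :> R by rewrite -expr2 sqrr_sign.
set e := (-1) ^+ n in ee *.
(* The two signs (-1)^n multiply to 1 and Gamma(s+1) = s Gamma(s) cancels the Gamma(s) > 0 of the
   Caputo derivative, leaving L(y) / (y - x)^(s+1). *)
have -> : 1 / (y - x) * F y
    - e * (s * Gamma_fun s) / ((y - x) `^ s * (y - x)) * (e / Gamma_fun s * w)
  = ((y - x) `^ s * F y - s * w) / ((y - x) `^ s * (y - x)).
  transitivity (1 / (y - x) * F y - (e * e) * (s * w) / ((y - x) `^ s * (y - x))).
    by field; rewrite !gt_eqF.
  by rewrite ee; field; rewrite !gt_eqF.
have DD0 : 0 < (y - x) `^ s * (y - x) by rewrite mulr_gt0.
rewrite normrM normfV (gtr0_norm DD0) ler_pdivrMr//.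
(* Multiplying [cle] by (y - x)^(s+1) turns its left side into the bound of [W]. *)
apply: (le_trans W); apply: le_trans (ler_wpM2r (ltW DD0) cle).
rewrite le_eqVlt; apply/orP; left; apply/eqP.
by field; rewrite !gt_eqF//; lra.
Qed.
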